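(* Let $y_1,\ldots,y_{s-1}$ be the generators of the free group $F_{s-1}$ given by $y_i=\tau_R(x_i)$, where $\tau_R\in\mathrm{Aut}(F_{s-1})$ is a lift of the Smith normal form matrix $R$ described in the context. (1) A set of generators for the free group $\ker(\pi\circ\alpha_{\overline d})$ is $$\{\,y_1^{\nu}y_jy_1^{-\nu}: 0\le\nu<n,\ 2\le j\le s-1\,\}\cup\{y_1^n\}.$$ The group $\ker(\pi\circ\alpha_{\overline d})$ is a free group of rank $(s-2)n+1$. (2) A set of generators for the group $\ker\alpha_{\overline d}$ is $$\{\,y_1^{\nu}y_jy_1^{-\nu}:\nu\in\mathbb{Z},\ 2\le j\le s-1\,\}.$$
   Context: $F_{s-1}$ is the free group on $x_1,\ldots,x_{s-1}$ ($s\ge 2$), $n\geq 1$ is an integer, $\overline d=(d_1,\ldots,d_{s-1})$ is a tuple of integers, none divisible by $n$, and $d=\gcd(d_1,\ldots,d_{s-1})$ satisfies $\gcd(d,n)=1$. The homomorphism $\alpha_{\overline d}:F_{s-1}\to d\mathbb{Z}$ is defined by $\alpha_{\overline d}(x_i)=d_i$, and $\pi:d\mathbb{Z}\to\mathbb{Z}/n\mathbb{Z}$ is reduction modulo $n$ (an epimorphism). Let $R=(r_{ij})\in\mathrm{SL}_{s-1}(\mathbb{Z})$ be a matrix with $(d_1,\ldots,d_{s-1})R=(d,0,\ldots,0)$ (Smith normal form of the row $(d_1,\ldots,d_{s-1})$). Since the natural map $\mathrm{Aut}(F_{s-1})\to\mathrm{GL}_{s-1}(\mathbb{Z})=\mathrm{Aut}(F_{s-1}/F_{s-1}')$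 is onto, $R$ lifts (non-uniquely) to an automorphism $\tau_R$ of $F_{s-1}$ such that $y_i=\tau_R(x_i)=x_1^{r_{1,i}}x_2^{r_{2,i}}\cdots x_{s-1}^{r_{s-1,i}}C_i$ with $C_i\in F_{s-1}'$ (the commutator subgroup), for $1\le i\le s-1$. *)

(* Defs.v *)
From HB Require Import structures.
From mathcomp Require Import all_boot all_order all_algebra.
From mathcomp Require Import boolp classical_sets.

Import GRing.Theory.

Set Implicit Arguments.
Unset Strict Implicit.
Unset Printing Implicit Defensive.

Local Open Scope group_scope.
Local Open Scope classical_set_scope.

Section Subgroups.
Variable G : groupType.
Implicit Types (A H : set G) (x : G).

Definition is_subgroup H : Prop :=
  [/\ H 1, forall x y, H x -> H y -> H (x * y) & forall x, H x -> H x^-1].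

Definition generated A : set G := smallest is_subgroup A.

Definition derived_subgroup : set G :=
  generated [set g | exists u v : G, g = [~ u, v]].

Definition expgz x (z : int) : G :=
  match z with Posz m => x ^+ m | Negz m => x ^- m.+1 end.

End Subgroups.

Arguments derived_subgroup : clear implicits.

Notation "x ^z m" := (expgz x m) (at level 30, no associativity) : group_scope.

Definition kernel (G H : groupType) (f : G -> H) : set G := f @^-1` [set 1].

(* A letter (x, false) stands for x and a letter (x, true) for x^-1; the       *)
(* elements of the free group on X are the reduced words in these letters.    *)
Section FreeGroup.
Variable X : choiceType.
Local Notation letter := (X * bool)%type.
Implicit Types (a b : letter) (u v w : seq letter).

Definition cancels a b := (a.1 == b.1) && (a.2 != b.2).

Definition reduced w := sorted (fun a b => ~~ cancels a b) w.

Definition letter_inv a : letter := (a.1, ~~ a.2).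

Definition cons_red a w :=
  if w is b :: w' then if cancels a b then w' else a :: w else [:: a].

Definition word_mul u v := foldr cons_red v u.

Definition word_inv w := rev (map letter_inv w).

Lemma letter_invK : involutive letter_inv.
Proof. by case=> x e; rewrite /letter_inv /= negbK. Qed.

Lemma cancelsE a b : cancels a b = (b == letter_inv a).
Proof.
case: a b => [x e] [y f]; rewrite /cancels /letter_inv /= xpair_eqE eq_sym.
by case: e; case: f.
Qed.

Lemma cons_red_reduced a w : reduced w -> reduced (cons_red a w).
Proof.
case: w => [//|b w] /= rw; case: ifP => [_|/negbT ab]; last by rewrite /= ab.
exact: path_sorted rw.
Qed.

Lemma cons_red_cons a w : reduced (a :: w) -> cons_red a w = a :: w.
Proof. by case: w => [//|b w] /= /andP[/negbTE -> _]. Qed.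

Lemma cons_redK a w : reduced w -> cons_red (letter_inv a) (cons_red a w) = w.
Proof.
case: w => [|b w] rw /=; first by rewrite cancelsE letter_invK eqxx.
case: ifP => [ab|_]; last by rewrite /= cancelsE letter_invK eqxx.
by move: ab rw; rewrite cancelsE => /eqP -> rw; rewrite cons_red_cons.
Qed.

Lemma word_mul_reduced u v : reduced v -> reduced (word_mul u v).
Proof. by move=> rv; elim: u => //= a u; apply: cons_red_reduced. Qed.

Lemma word_mul_cons_red a u w :
  reduced w -> word_mul (cons_red a u) w = cons_red a (word_mul u w).
Proof.
move=> rw; case: u => [//|b u] /=; case: ifP => // ab.
move: ab; rewrite cancelsE => /eqP ->.
have := cons_redK (letter_inv a) (word_mul_reduced u rw).
by rewrite letter_invK => ->.
Qed.

Lemma word_mulA u v w :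
  reduced w -> word_mul u (word_mul v w) = word_mul (word_mul u v) w.
Proof.
by move=> rw; elim: u => //= a u ->; rewrite word_mul_cons_red.
Qed.

Lemma word_mulw1 w : reduced w -> word_mul w [::] = w.
Proof.
elim: w => //= a w IHw raw; rewrite IHw ?cons_red_cons //.
exact: path_sorted raw.
Qed.

Lemma word_inv_reduced w : reduced w -> reduced (word_inv w).
Proof.
rewrite /reduced /word_inv rev_sorted sorted_map; apply: sub_sorted => a b /=.
rewrite /letter_inv /cancels /= eq_sym; case: (_ == _) => //=.
by case: a.2; case: b.2.
Qed.

Lemma word_invK : involutive word_inv.
Proof.
by move=> w; rewrite /word_inv map_rev revK -map_comp map_id_in // => a _ /=;
  exact: letter_invK.
Qed.

Lemma word_invKg w v : reduced v -> word_mul (word_inv w) (word_mul w v) = v.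
Proof.
move=> rv; elim: w => //= a w IHw.
rewrite /word_inv /= rev_cons /word_mul foldr_rcons -/(word_mul _ _).
by rewrite cons_redK ?word_mul_reduced // IHw.
Qed.

Lemma word_mulVw w : reduced w -> word_mul (word_inv w) w = [::].
Proof. by move=> rw; rewrite -[X in word_mul _ X]word_mulw1 // word_invKg. Qed.

Record free_group : Type := FreeGroup {
  word_of :> seq letter;
  _ : reduced word_of
}.

HB.instance Definition _ := [isSub for word_of].
HB.instance Definition _ := [Choice of free_group by <:].

Implicit Types f g h : free_group.

Definition fg_one : free_group := @FreeGroup [::] isT.

Definition fg_mul f g : free_group :=
  FreeGroup (word_mul_reduced (word_of f) (valP g)).

Definition fg_inv f : free_group := FreeGroup (word_inv_reduced (valP f)).

Lemma fg_mulA : associative fg_mul.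
Proof. by move=> f g h; apply/val_inj/word_mulA/valP. Qed.

Lemma fg_mul1 : left_id fg_one fg_mul.
Proof. by move=> f; apply: val_inj. Qed.

Lemma fg_mulr1 : right_id fg_one fg_mul.
Proof. by move=> f; apply/val_inj/word_mulw1/valP. Qed.

Lemma fg_mulV : left_inverse fg_one fg_inv fg_mul.
Proof. by move=> f; apply/val_inj/word_mulVw/valP. Qed.

Lemma fg_mulrV : right_inverse fg_one fg_inv fg_mul.
Proof.
move=> f; apply: val_inj => /=; rewrite -[X in word_mul X]word_invK.
exact/word_mulVw/word_inv_reduced/valP.
Qed.

HB.instance Definition _ :=
  isGroup.Build free_group fg_mulA fg_mul1 fg_mulr1 fg_mulV fg_mulrV.

Definition fg_gen (x : X) : free_group := @FreeGroup [:: (x, false)] isT.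

Section Lift.
Variables (G : groupType) (phi : X -> G).

Definition letter_eval a : G := if a.2 then (phi a.1)^-1 else phi a.1.

Definition word_eval w : G := \prod_(a <- w) letter_eval a.

(* The homomorphism given by the universal property of the free group.       *)
Definition fg_lift f : G := word_eval (word_of f).

Lemma word_eval_cons_red a w :
  word_eval (cons_red a w) = letter_eval a * word_eval w.
Proof.
rewrite /word_eval; case: w => [|b w] /=; first by rewrite big_seq1 big_nil mulg1.
rewrite big_cons; case: ifP => [|_]; last by rewrite !big_cons.
rewrite cancelsE => /eqP ->; rewrite mulgA.
suff -> : letter_eval a * letter_eval (letter_inv a) = 1 by rewrite mul1g.
by rewrite /letter_eval /letter_inv /=; case: a.2; rewrite /= (mulVg, mulgV).
Qed.

Lemma fg_liftM : {morph fg_lift : f g / f * g}.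
Proof.
move=> f g; rewrite /fg_lift /= /fg_mul /=.
elim: (word_of f) => [|a w IHw] /=; first by rewrite {2}/word_eval big_nil mul1g.
by rewrite word_eval_cons_red IHw mulgA /word_eval big_cons.
Qed.

Lemma fg_lift_gen x : fg_lift (fg_gen x) = phi x.
Proof. by rewrite /fg_lift /word_eval big_seq1. Qed.

End Lift.

HB.instance Definition _ (G : groupType) (phi : X -> G) :=
  isMultiplicative.Build free_group G (fg_lift phi) (fg_liftM phi).

End FreeGroup.

Arguments fg_gen {X} x.

Definition free_of_rank (G : groupType) (H : set G) (k : nat) : Prop :=
  exists phi : {multiplicative free_group 'I_k -> G},
    injective phi /\ range phi = H.

Section Multiples.
Variable d : int.

Record multiples : Type := Multiple {
  int_of_multiple :> int;
  _ : int_of_multiple \in dvdz d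
}.

HB.instance Definition _ := [isSub for int_of_multiple].
HB.instance Definition _ := [Choice of multiples by <:].

HB.instance Definition _ := [SubChoice_isSubZmodule of multiples by <:].

End Multiples.

Section ReduceMod.
Variable d : int.

(* The additive group Z/nZ, for n >= 1, is 'I_n, whose canonical structure   *)
(* requires the shape 'I_(_.+1); 'Z_n would be wrong for n = 1.              *)
Definition reduce_mod (n : nat) :
    Algebra.to_multiplicative (multiples d) ->
    Algebra.to_multiplicative 'I_n.-1.+1 :=
  fun z => ((inZp 1 : 'I_n.-1.+1) *~ int_of_multiple z)%R.

Lemma reduce_modM n : {morph reduce_mod n : y z / y * z}.
Proof. by move=> y z; apply: mulrzDr_tmp. Qed.

HB.instance Definition _ n :=
  isMultiplicative.Build _ _ (reduce_mod n) (reduce_modM n).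

End ReduceMod.

Arguments reduce_mod {d} n z.

Section Alpha.
Variables (m : nat) (dbar : 'rV[int]_m).

Definition gcd_row : int := \big[gcdz/0%Z]_(i < m) dbar 0%R i.

Lemma gcd_row_dvd i : (gcd_row %| dbar 0%R i)%Z.
Proof.
rewrite /gcd_row; have : i \in index_enum 'I_m by rewrite mem_index_enum.
elim: (index_enum _) => //= j r IHr; rewrite inE big_cons.
case/predU1P => [->|/IHr]; first exact: dvdz_gcdl.
by apply: dvdz_trans; apply: dvdz_gcdr.
Qed.

Definition alpha :
    free_group 'I_m -> Algebra.to_multiplicative (multiples gcd_row) :=
  fg_lift (fun i => Multiple (gcd_row_dvd i)
                    : Algebra.to_multiplicative (multiples gcd_row)).

HB.instance Definition _ := Multiplicative.on alpha.

End Alpha.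

Lemma gt1_pred_gt0 s : (1 < s)%N -> (0 < s.-1)%N.
Proof. by case: s => [|[]]. Qed.

Definition ord_first s (hs : (1 < s)%N) : 'I_s.-1 := Ordinal (gt1_pred_gt0 hs).

(* The endomorphism tau induces the matrix M on the abelianization.          *)
Definition lifts_matrix m (M : 'M[int]_m)
    (tau : free_group 'I_m -> free_group 'I_m) : Prop :=
  forall i, exists2 C, derived_subgroup (free_group 'I_m) C
    & tau (fg_gen i) = (\prod_(k < m) fg_gen k ^z M k i) * C.

(* Main.v *)
(* As alpha (tau x_i) is the i-th entry of dbar R, alpha o tau is d times the
   height h, the exponent sum of x_1. Let K be the subgroup generated by the
   y_1^nu y_j y_1^-nu with nu in Z, j >= 2. It is normalised by y_1, so every
   element of the free group has the form k y_1^h with k in K. As d <> 0, this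
   gives ker alpha = K. As gcd(d, n) = 1, it also shows that
   ker (pi o alpha) is generated by K and y_1^n, and dividing nu by n leaves
   only the exponents 0 <= nu < n.
   For freeness, let L be the free group on (s-2)n+1 letters, one for each of
   these generators. The free group of rank s-1 acts on L x Z/n, modelled on
   its own left translation action (the second coordinate is the left coset of
   the kernel), in such a way that the generator named by the letter l sends
   (g, 0) to (l g, 0). Hence the element named by a word v
   sends (1, 0) to (v, 0), and it is trivial only if v is. *)
Require Import Defs.
From HB Require Import structures.
From mathcomp Require Import all_boot all_order all_algebra.
From mathcomp Require Import boolp classical_sets.
From mathcomp Require Import zify.

Import GRing.Theory.

Set Implicit Arguments.
Unset Strict Implicit.
Unset Printing Implicit Defensive.

Local Open Scope group_scope.
Local Open Scope classical_set_scope.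

(** * Group homomorphisms, generated subgroups and integer powers *)

Section GroupHom.
Variables (G H : groupType) (f : {multiplicative G -> H}).

Lemma group_hom1 : f 1 = 1.
Proof. by apply: (mulgI (f 1)); rewrite -gmulfM !mulg1. Qed.

Lemma group_homV : {morph f : x / x^-1}.
Proof.
by move=> x; apply: (mulgI (f x)); rewrite -gmulfM !mulgV group_hom1.
Qed.

Lemma group_homXn n : {morph f : x / x ^+ n}.
Proof.
by move=> x; elim: n => [|n IHn]; rewrite ?group_hom1 // !expgS gmulfM IHn.
Qed.

End GroupHom.

Section Generated.
Variable G : groupType.
Implicit Types (A H : set G) (x : G).

Lemma generated_subgroup A : is_subgroup (generated A).
Proof.
split=> [|x y gx gy|x gx] H [sH AH]; have [H1 HM HV] := sH => //.
- by apply: HM; [apply: gx|apply: gy].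
- by apply: HV; apply: gx.
Qed.

Lemma sub_generated A : A `<=` generated A.
Proof. exact: sub_gen_smallest. Qed.

Lemma generated_min A H : is_subgroup H -> A `<=` H -> generated A `<=` H.
Proof. exact: smallest_sub. Qed.

Lemma subgroupXz H x z : is_subgroup H -> H x -> H (x ^z z).
Proof.
move=> [H1 HM HV] Hx.
have HX n : H (x ^+ n) by elim: n => // n IHn; rewrite expgS; apply: HM.
by case: z => n //=; apply: HV.
Qed.

Lemma expgzS x z : x ^z (z + 1)%R = x ^z z * x.
Proof.
case: z => n /=; first by rewrite addn1 expgSr.
case: n => [|n]; first by rewrite expg1 mulVg.
have -> : (Negz n.+1 + 1)%R = Negz n by lia.
by rewrite /= [in RHS]expgS invgM mulgVK.
Qed.

Lemma expgzD x a b : x ^z (a + b)%R = x ^z a * x ^z b.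
Proof.
elim/int_rec: b => [|n IHn|n IHn]; first by rewrite addr0 mulg1.
  have -> : Posz n.+1 = (n%:Z + 1)%R by lia.
  by rewrite addrA !expgzS IHn mulgA.
apply: (mulIg x); rewrite -mulgA -!expgzS.
have -> : (- n.+1%:Z + 1 = - n%:Z)%R by lia.
by have -> : (a - n.+1%:Z + 1 = a - n%:Z)%R by lia.
Qed.

Lemma expgzN x a : x ^z (- a)%R = (x ^z a)^-1.
Proof. by apply: (mulIg (x ^z a)); rewrite -expgzD addNr mulVg. Qed.

Lemma expgzM x n z : x ^z (n%:Z * z)%R = (x ^+ n) ^z z.
Proof.
case: z => k; first by rewrite -PoszM /= expgnA.
by rewrite NegzE mulrN !expgzN -PoszM /= expgnA.
Qed.

Lemma kernel_subgroup (H : groupType) (f : {multiplicative G -> H}) :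
  is_subgroup (kernel f).
Proof.
split; rewrite /kernel /preimage /=; first exact: group_hom1.
  by move=> x y fx fy; rewrite gmulfM fx fy mulg1.
by move=> x fx; rewrite group_homV fx invg1.
Qed.

End Generated.

(** * Free groups: induction, homomorphisms and actions *)

Section FreeGroupTheory.
Variable X : choiceType.
Implicit Types (w : free_group X).

(** Removing the first letter of a reduced word leaves a reduced word. *)
Lemma free_group_ind (H : set (free_group X)) :
  is_subgroup H -> (forall x, H (fg_gen x)) -> forall w, H w.
Proof.
move=> [H1 HM HV] Hgen [w rw].
elim: w rw => [|[x e] w IHw] rw.
  by rewrite (_ : FreeGroup rw = 1) //; apply: val_inj.
have rw' : reduced w by apply: path_sorted rw.
pose l : free_group X := if e then (fg_gen x)^-1 else fg_gen x.
have -> : FreeGroup rw = l * FreeGroup rw'.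
  apply: val_inj; rewrite -[LHS](cons_red_cons rw) /l /=.
  by case: (e).
by apply: HM => //; rewrite /l; case: (e) => //; apply: HV.
Qed.

Lemma free_group_hom_ext (G : groupType)
    (f g : {multiplicative free_group X -> G}) :
  (forall x, f (fg_gen x) = g (fg_gen x)) -> f =1 g.
Proof.
move=> fg; apply: (@free_group_ind [set w | f w = g w]) => //.
split=> [|u v|u] /=; first by rewrite !group_hom1.
  by rewrite !gmulfM => -> ->.
by rewrite !group_homV => ->.
Qed.

Lemma range_fg_lift (G : groupType) (phi : X -> G) :
  range (fg_lift phi) = generated (range phi).
Proof.
apply/seteqP; split.
  move=> _ [w _ <-]; move: w.
  have [g1 gM gV] := generated_subgroup (range phi).
  apply: (@free_group_ind [set w | generated (range phi) (fg_lift phi w)]).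
    split=> [|u v|u] /=; first by rewrite group_hom1.
      by rewrite gmulfM; apply: gM.
    by rewrite group_homV; apply: gV.
  by move=> x /=; rewrite fg_lift_gen; apply: sub_generated; exists x.
apply: generated_min.
  split=> [|_ _ [u _ <-] [v _ <-]|_ [u _ <-]].
  - by exists 1 => //; rewrite group_hom1.
  - by exists (u * v) => //; rewrite gmulfM.
  - by exists u^-1 => //; rewrite group_homV.
by move=> _ [x _ <-]; exists (fg_gen x) => //; rewrite fg_lift_gen.
Qed.

Lemma fg_liftV (G : groupType) (phi : X -> G) :
  {morph fg_lift phi : w / w^-1}.
Proof. exact: group_homV. Qed.

Lemma fg_liftXn (G : groupType) (phi : X -> G) n :
  {morph fg_lift phi : w / w ^+ n}.
Proof. exact: group_homXn. Qed.

Section Action.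
Variables (S : Type) (act : X * bool -> S -> S).
Hypothesis actK : forall a, cancel (act (letter_inv a)) (act a).

Definition free_group_act (w : free_group X) (s : S) : S :=
  foldr act s (word_of w).

(** Reduction only cancels adjacent inverse letters, and by [actK] such a pair acts trivially. *)
Lemma free_group_actM u v s :
  free_group_act (u * v) s = free_group_act u (free_group_act v s).
Proof.
rewrite /free_group_act /=; elim: (word_of u) => //= a w <-.
case: (word_mul _ _) => //= b t; case: ifP => //.
by rewrite cancelsE => /eqP ->; rewrite actK.
Qed.

Lemma free_group_actVE w s t :
  free_group_act w s = t -> free_group_act w^-1 t = s.
Proof. by move=> <-; rewrite -free_group_actM mulVg. Qed.

End Action.

End FreeGroupTheory.

(** Freeness criterion: [emb] carries left translation into the action, so [phi v] moves [emb 1] to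
    [emb v], which determines [v]. *)
Lemma free_group_act_inj (X Y : choiceType) (S : Type)
    (act : X * bool -> S -> S) (emb : free_group Y -> S)
    (phi : {multiplicative free_group Y -> free_group X}) :
    (forall a, cancel (act (letter_inv a)) (act a)) ->
    (forall y g,
      free_group_act act (phi (fg_gen y)) (emb g) = emb (fg_gen y * g)) ->
  injective emb -> injective phi.
Proof.
move=> actK phi_gen emb_inj.
have phi_act : forall v g, free_group_act act (phi v) (emb g) = emb (v * g).
  apply: (@free_group_ind _
    [set v | forall g, free_group_act act (phi v) (emb g) = emb (v * g)]) => //.
  split=> [g|u v IHu IHv g|u IHu g].
  - by rewrite group_hom1 mul1g.
  - by rewrite gmulfM (free_group_actM actK) IHv IHu mulgA.
  - by rewrite group_homV; apply: (free_group_actVE actK); rewrite IHu mulVKg.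
move=> u v eq_uv; have := phi_act v 1; rewrite -eq_uv phi_act !mulg1.
exact: emb_inj.
Qed.

(** An enumeration of [Y] renames the generators; [g] and [h] are mutually inverse renamings. *)
Lemma free_of_rank_card (Y : finType) (G : groupType)
    (f : {multiplicative free_group Y -> G}) :
  injective f -> free_of_rank (range f) #|Y|.
Proof.
move=> f_inj.
pose g := fg_lift (fun i : 'I_#|Y| => fg_gen (enum_val i)).
pose h := fg_lift (fun y : Y => fg_gen (enum_rank y)).
have ghK : cancel h g.
  apply: (free_group_hom_ext (f := g \o h) (g := idfun)) => y /=.
  by rewrite /h /g !fg_lift_gen enum_rankK.
have hgK : cancel g h.
  apply: (free_group_hom_ext (f := h \o g) (g := idfun)) => y /=.
  by rewrite /h /g !fg_lift_gen enum_valK.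
exists (f \o g); split; first exact: inj_comp f_inj (can_inj hgK).
apply/seteqP; split=> _ [w _ <-]; first by exists (g w).
by exists (h w) => //; exact: (congr1 f (ghK w) : (f \o g) (h w) = f w).
Qed.

(** * Schreier generators and the cyclic cover of degree [n.+1] *)

Section CyclicCover.
Variables (m n : nat).
Local Notation F := (free_group 'I_m.+1).
Local Notation Y := (option ('I_n.+1 * 'I_m)%type).

(** Schreier generators for the transversal of powers [x ord0 ^+ nu] with [nu <= n]; the modulus is
    [n.+1]. *)
Definition schreier_gen (G : groupType) (x : 'I_m.+1 -> G) (y : Y) : G :=
  if y is Some (nu, j) then x ord0 ^+ nu * x (lift ord0 j) * x ord0 ^- nu
  else x ord0 ^+ n.+1.

(** The factor c in x_i x_0^-nu = x_0^-mu c, where mu is nu - [shift i] modulo n+1. For i = 0 it is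
    nontrivial only when nu wraps around from 0 to n, and then c names x_0^(n+1). *)
Definition cocycle (i : 'I_m.+1) (nu : 'I_n.+1) : free_group Y :=
  if unlift ord0 i is Some j then fg_gen (Some (nu, j))
  else if nu == 0%R then fg_gen None else 1.

Definition shift (i : 'I_m.+1) : 'I_n.+1 := inZp (i == ord0).

(* The pair (g, nu) stands for x_0^-nu g, where g is read in the generators
   schreier_gen, and the action is left multiplication. *)
Definition cover_act (a : 'I_m.+1 * bool) (s : free_group Y * 'I_n.+1) :
    free_group Y * 'I_n.+1 :=
  let: (g, nu) := s in
  if a.2 then ((cocycle a.1 (nu + shift a.1)%R)^-1 * g, (nu + shift a.1)%R)
  else (cocycle a.1 nu * g, (nu - shift a.1)%R).

Lemma cover_actK a : cancel (cover_act (letter_inv a)) (cover_act a).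
Proof.
case: a => i [] [g nu] /=; first by rewrite subrK mulKg.
by rewrite addrK mulVKg.
Qed.

Local Notation act := (free_group_act cover_act).
Local Notation x0 := (fg_gen ord0 : F).

(** The second coordinate descends from [k <= n] to 0 without wrapping around, so every cocycle
    factor on the way is 1. *)
Lemma cover_act_root k g : (k <= n)%N ->
  act (x0 ^+ k) (g, inZp k) = (g, 0%R).
Proof.
elim: k => [_|k IHk ltkn].
  by rewrite /free_group_act /=; congr (_, _); apply: val_inj; rewrite /= mod0n.
rewrite expgSr (free_group_actM cover_actK).
rewrite -[RHS]IHk 1?ltnW //; congr (act _ _).
rewrite /free_group_act /= /cocycle unlift_none /shift eqxx.
have -> : (inZp k.+1 == 0%R :> 'I_n.+1) = false.
  by apply/negP => /eqP/(congr1 val) /=; rewrite modn_small.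
rewrite mul1g; congr (_, _); apply/eqP; rewrite subr_eq; apply/eqP.
by apply: val_inj; rewrite /= modnDm addn1.
Qed.

(** For [Some (nu, j)] the three factors, from the right, move 0 to nu, multiply by the named
    letter, and move nu back to 0. For [None] the rightmost x_0 wraps around to n, which yields the
    named letter, and the other n descend to 0. *)
Lemma schreier_gen_act (y : Y) g :
  act (schreier_gen fg_gen y) (g, 0%R) = (fg_gen y * g, 0%R).
Proof.
case: y => [[nu j]|] /=.
  have nuE : nu = inZp nu by apply: val_inj; rewrite /= modn_small.
  have lenu : (nu <= n)%N by rewrite -ltnS.
  rewrite !(free_group_actM cover_actK).
  rewrite (free_group_actVE cover_actK (cover_act_root g lenu)).
  rewrite -[RHS](cover_act_root _ lenu); congr (act _ _).
  rewrite /free_group_act /= /cocycle liftK /shift -nuE /=.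
  congr (_, _); apply/eqP; rewrite subr_eq; apply/eqP.
  by apply: val_inj; rewrite /= mod0n addn0 modn_small.
rewrite expgSr (free_group_actM cover_actK).
rewrite -[RHS](cover_act_root _ (leqnn n)); congr (act _ _).
rewrite /free_group_act /= /cocycle unlift_none /shift !eqxx /=.
congr (_, _); apply/eqP; rewrite subr_eq; apply/eqP.
by apply: val_inj; rewrite /= modnDm addn1 modnn.
Qed.

Lemma schreier_gen_free :
  injective (fg_lift (schreier_gen (fg_gen : 'I_m.+1 -> F))).
Proof.
apply: (free_group_act_inj (act := cover_act) (emb := fun g => (g, 0%R))).
- exact: cover_actK.
- by move=> y g; rewrite -schreier_gen_act -(fg_lift_gen (schreier_gen fg_gen)).
- by move=> g h [].
Qed.

(** The injective map [fg_lift x] transports freeness from the standard basis to the family [x]. *)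
Lemma schreier_gen_free_of_rank (G : groupType) (x : 'I_m.+1 -> G) :
  injective (fg_lift x) ->
  free_of_rank (generated (range (schreier_gen x))) (n.+1 * m).+1.
Proof.
move=> x_inj.
have liftE w : fg_lift (schreier_gen x) w =
    fg_lift x (fg_lift (schreier_gen fg_gen) w).
  move: w; apply: (free_group_hom_ext
    (g := fg_lift x \o fg_lift (schreier_gen fg_gen))) => z /=.
  rewrite !fg_lift_gen; case: z => [[nu j]|] /=; last first.
    by rewrite fg_liftXn fg_lift_gen.
  by rewrite !fg_liftM fg_liftV fg_liftXn !fg_lift_gen.
have -> : (n.+1 * m).+1 = #|(Y : finType)|.
  by rewrite card_option card_prod !card_ord.
rewrite -range_fg_lift; apply: free_of_rank_card.
have lift_inj : injective (fg_lift (schreier_gen x)).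
  by move=> u v; rewrite !liftE => /x_inj /schreier_gen_free.
exact: lift_inj.
Qed.

End CyclicCover.

(** * Height, and the normal form k x_0^h *)

Section Height.
Variable m : nat.

Definition height : free_group 'I_m.+1 -> Algebra.to_multiplicative int :=
  fg_lift (fun i => (Posz (i == ord0) : Algebra.to_multiplicative int)).

HB.instance Definition _ := Multiplicative.on height.

Lemma heightM u v : height (u * v) = (height u + height v)%R.
Proof. exact: fg_liftM. Qed.

Lemma heightV u : height u^-1 = (- height u)%R.
Proof. exact: group_homV. Qed.

Variables (G : groupType) (x : 'I_m.+1 -> G).

Definition shifted_gens : set G :=
  [set g | exists (nu : int) (j : 'I_m.+1),
     (1 <= j)%N /\ g = x ord0 ^z nu * x j * x ord0 ^z (- nu)%R].

(** Conjugation by [x ord0 ^z a] replaces nu by a + nu in each generator. *)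
Lemma shifted_gens_conj g a : generated shifted_gens g ->
  generated shifted_gens (x ord0 ^z a * g * x ord0 ^z (- a)%R).
Proof.
have [K1 KM KV] := generated_subgroup shifted_gens.
apply: (@generated_min _ _ [set g |
  generated shifted_gens (x ord0 ^z a * g * x ord0 ^z (- a)%R)]).
  split=> [|u v Ku Kv|u Ku] /=.
  - by rewrite mulg1 expgzN mulgV.
  - have := KM _ _ Ku Kv; rewrite expgzN.
    by rewrite !mulgA mulgVK.
  - by have := KV _ Ku; rewrite expgzN !invgM invgK mulgA.
move=> _ [nu [j [j_gt0 ->]]] /=; apply: sub_generated.
exists (a + nu)%R, j; split=> //.
by rewrite opprD [(- a - nu)%R]addrC !expgzD !mulgA.
Qed.

(** Products keep the normal form, as k x_0^a l x_0^b = k (x_0^a l x_0^-a) x_0^(a+b); inverses are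
    treated in the same way. *)
Lemma shifted_gens_height w :
  exists2 k, generated shifted_gens k & fg_lift x w = k * x ord0 ^z (height w).
Proof.
have [K1 KM KV] := generated_subgroup shifted_gens.
move: w; apply: (@free_group_ind _ [set w | exists2 k, _ & _ = _]%classic).
  split=> [|u v [k Kk uE] [l Kl vE]|u [k Kk uE]] /=.
  - by exists 1; rewrite ?group_hom1 ?mulg1.
  - exists (k * (x ord0 ^z (height u) * l * x ord0 ^z (- height u)%R)).
      by apply: KM => //; apply: shifted_gens_conj.
    rewrite fg_liftM heightM uE vE.
    by rewrite expgzD expgzN !mulgA mulgVK.
  - exists (x ord0 ^z (- height u)%R * k^-1 * x ord0 ^z (- - height u)%R).
      by apply: shifted_gens_conj; apply: KV.
    rewrite fg_liftV heightV uE.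
    by rewrite !expgzN invgK invgM mulgK.
move=> i /=; rewrite /height !fg_lift_gen.
case: (unliftP ord0 i) => [j ->|->].
  exists (x (lift ord0 j)); last by rewrite mulg1.
  apply: sub_generated; exists 0%R, (lift ord0 j); split=> //.
  by rewrite mul1g mulg1.
by exists 1; rewrite // mul1g.
Qed.

End Height.

(** * Integer values of [alpha] and the two kernels *)

Section Alpha.
Variables (m : nat) (dbar : 'rV[int]_m).

Definition alphaz (w : free_group 'I_m) : int := int_of_multiple (alpha dbar w).

Lemma alphaz1 : alphaz 1 = 0%R.
Proof. by rewrite /alphaz group_hom1. Qed.

Lemma alphazM u v : alphaz (u * v) = (alphaz u + alphaz v)%R.
Proof. by rewrite /alphaz gmulfM. Qed.

Lemma alphazV u : alphaz u^-1 = (- alphaz u)%R.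
Proof. by rewrite /alphaz group_homV. Qed.

Lemma alphaz_gen i : alphaz (fg_gen i) = dbar ord0 i.
Proof. by rewrite /alphaz /alpha fg_lift_gen. Qed.

Lemma alphazX w z : alphaz (w ^z z) = (z * alphaz w)%R.
Proof.
have aX k : alphaz (w ^+ k) = (k%:Z * alphaz w)%R.
  elim: k => [|k IHk]; first by rewrite alphaz1 mul0r.
  by rewrite expgS alphazM IHk intS mulrDl mul1r.
by case: z => k; rewrite /= ?NegzE ?alphazV aX ?mulNr.
Qed.

Lemma alphaz_derived w : derived_subgroup (free_group 'I_m) w -> alphaz w = 0%R.
Proof.
apply: (@generated_min _ _ [set w | alphaz w = 0%R]).
  split=> [|u v au av|u au] /=; first exact: alphaz1.
    by rewrite alphazM au av addr0.
  by rewrite alphazV au oppr0.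
by move=> _ [u [v ->]] /=; rewrite commgEl conjgE !alphazM !alphazV; lia.
Qed.

Lemma alphaz_lift (M : 'M[int]_m)
    (tau : free_group 'I_m -> free_group 'I_m) i :
  lifts_matrix M tau -> alphaz (tau (fg_gen i)) = ((dbar *m M) ord0 i)%R.
Proof.
move=> /(_ i) [C /alphaz_derived aC ->]; rewrite alphazM aC addr0 mxE.
rewrite (big_morph _ alphazM alphaz1); apply: eq_bigr => k _.
by rewrite alphazX alphaz_gen mulrC.
Qed.

Lemma kernel_alphaE w : kernel (alpha dbar) w <-> alphaz w = 0%R.
Proof. by split=> [aw|aw]; [rewrite /alphaz aw | apply: val_inj]. Qed.

Lemma kernel_reduce_modE n w : (0 < n)%N ->
  kernel (reduce_mod n \o alpha dbar) w <-> (n%:Z %| alphaz w)%Z.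
Proof.
case: n => // n _; rewrite /kernel /preimage /= /reduce_mod -/(alphaz w).
have inZpX k : (inZp 1 *+ k)%R = inZp k :> 'I_n.+1.
  elim: k => [|k IHk]; first by apply: val_inj; rewrite /= mod0n.
  by rewrite mulrS IHk; apply: val_inj; rewrite /= modnDm add1n.
have inZp0 k : (inZp k = 0%R :> 'I_n.+1) <-> (n.+1 %| k)%N.
  by split=> [/(congr1 val)/= /eqP|/eqP k0] //; apply: val_inj.
rewrite /dvdz /=; case: (alphaz w) => k /=.
  by rewrite -pmulrn inZpX.
(* For a negative value, a residue vanishes exactly when its opposite does. *)
rewrite NegzE mulrNz -pmulrn inZpX -inZp0.
split; first by move/(congr1 (fun z : 'I_n.+1 => - z)%R); rewrite opprK oppr0.
by move=> ->; exact: oppr0.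
Qed.

End Alpha.

Theorem theorem4 (s : nat) (hs : (2 <= s)%N) (n : nat) (hn : (1 <= n)%N)
    (dbar : 'rV[int]_s.-1)
    (hdbar : forall i, ~~ (n%:Z %| dbar ord0 i)%Z)
    (hdn : coprimez (gcd_row dbar) n%:Z)
    (R : 'M[int]_s.-1) (hR : (\det R = 1)%R)
    (hdR : (dbar *m R = gcd_row dbar *: delta_mx 0 (ord_first hs))%R)
    (tau : {multiplicative free_group 'I_s.-1 -> free_group 'I_s.-1})
    (htau : bijective tau) (htauR : lifts_matrix R tau) :
  let y i := tau (fg_gen i) in
  let y1 := y (ord_first hs) in
  [/\ generated
        ([set w | exists (nu : nat) (j : 'I_s.-1),
            [/\ (0 <= nu < n)%N, (1 <= j)%N & w = y1 ^+ nu * y j * y1 ^- nu]]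
         `|` [set y1 ^+ n])
      = kernel (reduce_mod n \o alpha dbar),
      free_of_rank (kernel (reduce_mod n \o alpha dbar)) ((s - 2) * n + 1)
    & generated
        [set w | exists (nu : int) (j : 'I_s.-1),
           (1 <= j)%N /\ w = y1 ^z nu * y j * y1 ^z (- nu)%R]
      = kernel (alpha dbar)].
Proof.
(* From here on [s] is [m.+2], and the modulus becomes [n.+1]. *)
case: s hs dbar hdbar hdn R hR hdR tau htau htauR => [|[|m]] // hs dbar.
case: n hn => // n _ hdbar hdn R _ hdR tau htau htauR y y1.
have first0 : ord_first hs = ord0 by apply: val_inj.
have y1E : y1 = y ord0 by rewrite /y1 first0.
(* If the gcd were 0, coprimality would make the modulus 1, which divides every entry of [dbar]. *)
have gcd_neq0 : gcd_row dbar != 0%R.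
  apply/eqP => d0; have /negP := hdbar ord0; apply.
  move: hdn; rewrite d0 /coprimez gcd0z => n0.
  by have -> : n = 0 by lia.
have alpha_y i : alphaz dbar (y i) = (gcd_row dbar * (i == ord0)%:Z)%R.
  by rewrite (alphaz_lift _ _ htauR) hdR first0 !mxE eqxx natz.
have tauE w : tau w = fg_lift y w.
  by move: w; apply: free_group_hom_ext => i; rewrite [RHS]fg_lift_gen.
have alpha_tau w : alphaz dbar (tau w) = (gcd_row dbar * height w)%R.
  move: w; apply: (@free_group_ind _
    [set w | alphaz dbar (tau w) = (gcd_row dbar * height w)%R]).
    split=> [|u v au av|u au] /=.
    - by rewrite group_hom1 alphaz1 [height 1](group_hom1 (@height m)) mulr0.
    - by rewrite gmulfM alphazM heightM au av mulrDr.
    - by rewrite group_homV alphazV heightV au mulrN.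
  by move=> i /=; rewrite -/(y i) alpha_y /height fg_lift_gen.
set A1 := (X in generated X = kernel (_ \o _)).
set A2 := (X in generated X = kernel (alpha _)).
have A2E : A2 = shifted_gens y by rewrite /A2 /shifted_gens y1E.
have [tau' tauK tau'K] := htau.
have ker2 : generated A2 = kernel (alpha dbar).
  apply/seteqP; split.
    apply: generated_min; first exact: kernel_subgroup.
    move=> _ [nu [j [j_gt0 ->]]]; apply/kernel_alphaE.
    rewrite !alphazM !alphazX !alpha_y -(val_eqE j) /= eqn0Ngt j_gt0.
    lia.
  (* The height of [tau' v] is 0, so the power of [y1] in the normal form of [v] disappears. *)
  move=> v /kernel_alphaE; rewrite -[v]tau'K alpha_tau A2E tauE => /eqP.
  rewrite mulf_eq0 (negbTE gcd_neq0) /= => /eqP h0.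
  have [k Kk ->] := shifted_gens_height y (tau' v).
  by rewrite h0 mulg1.
have [K1 KM KV] := generated_subgroup A1.
have A2_sub : generated A2 `<=` generated A1.
  apply: generated_min; first exact: generated_subgroup.
  move=> _ [nu [j [j_gt0 ->]]].
  have [r r_lt rE] : exists2 r : nat, (r < n.+1)%N & (nu %% n.+1)%Z = r.
    by exists `|(nu %% n.+1)%Z|%N; lia.
  (* Conjugation by [Yq], a power of the generator [y1 ^+ n.+1], raises the exponent from the
     remainder [r] to [nu]. *)
  set Yq := (y1 ^+ n.+1) ^z (nu %/ n.+1)%Z; have KY : generated A1 Yq.
    apply: (subgroupXz _ (generated_subgroup A1)).
    by apply: sub_generated; right.
  have -> : y1 ^z nu * y j * y1 ^z (- nu)%R =
      Yq * (y1 ^+ r * y j * y1 ^- r) * Yq^-1.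
    rewrite expgzN {1 2}(divz_eq nu n.+1) rE mulrC expgzD expgzM invgM.
    by rewrite !mulgA.
  apply: (KM) (KV _ KY); apply: KM => //.
  by apply: sub_generated; left; exists r, j.
have ker1 : generated A1 = kernel (reduce_mod n.+1 \o alpha dbar).
  apply/seteqP; split.
    apply: generated_min; first exact: kernel_subgroup.
    move=> v [[nu [j [_ j_gt0 ->]]]|->]; apply/kernel_reduce_modE => //.
      rewrite !alphazM alphazV alpha_y -(val_eqE j) /= eqn0Ngt j_gt0.
      by rewrite mulr0 addr0 subrr dvdz0.
    by rewrite -[y1 ^+ _]/(y1 ^z n.+1) alphazX dvdz_mulr.
  move=> v /kernel_reduce_modE-/(_ isT).
  (* By coprimality the modulus divides the height itself, so the power of [y1] in the normal form
     is a power of [y1 ^+ n.+1]. *)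
  rewrite -[v]tau'K alpha_tau tauE Gauss_dvdzr 1?coprimez_sym //.
  have [k Kk ->] := shifted_gens_height y (tau' v).
  move=> /dvdzP[q ->]; rewrite mulrC expgzM -y1E.
  apply: KM; first by apply: A2_sub; rewrite A2E.
  apply: (subgroupXz _ (generated_subgroup A1)).
  by apply: sub_generated; right.
split=> //.
(* The [y i] form a basis, because [fg_lift y] is the automorphism [tau]. *)
have y_inj : injective (fg_lift y).
  by move=> u v; rewrite -!tauE; apply: (bij_inj htau).
have := schreier_gen_free_of_rank n y_inj.
rewrite -ker1 (_ : ((m.+2 - 2) * n.+1 + 1)%N = (n.+1 * m).+1); last lia.
(* The indices [1 <= j] are exactly the values of [lift ord0], and [None] names [y1 ^+ n.+1]. *)
rewrite (_ : range _ = A1) //; apply/seteqP; split.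
  move=> _ [[[nu j]|] _ <-] /=; rewrite -y1E; last by right.
  by left; exists nu, (lift ord0 j); rewrite ltn_ord.
move=> _ [[nu [j [/= nu_lt j_gt0 ->]]]|->]; last first.
  by exists None; rewrite //= -y1E.
case: (unliftP ord0 j) j_gt0 => [i ->|->] // _.
by exists (Some (Ordinal nu_lt, i)); rewrite //= -y1E.
Qed.
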